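(* Let $m\ge n\ge 2$ be integers and $\xi$ a transcendental real number. Then at least one of the following holds: (i) $w_{n-1}(\xi)=w_{n}(\xi)=w_{n+1}(\xi)=\cdots=w_{m}(\xi)$; (ii) $\displaystyle \widehat{w}_{n}(\xi)\leq m+(n-1)\frac{\widehat{w}_{n}(\xi)}{w_{m}(\xi)}$. Equivalently, $w_{n-1}(\xi)<w_{m}(\xi)$ implies (ii).
   Context: The height $H(P)$ of an integer polynomial $P$ is the maximum of the absolute values of its coefficients. For a real number $\xi$ and integer $k\ge1$: $w_{k}(\xi)\in[0,+\infty]$ is the supremum of the real numbers $w$ such that $0<|P(\xi)|\le H(P)^{-w}$ has infinitely many solutions $P\in\mathbb{Z}[X]$ of degree at most $k$; $\widehat{w}_{k}(\xi)$ is the supremum of the real numbers $w$ such that for all sufficiently large $H$ the system $0<|P(\xi)|\le H^{-w}$, $H(P)\le H$, has a solution $P\in\mathbb{Z}[X]$ of degree at most $k$. The value $w_m(\xi)$ may be $+\infty$, in which case the quotient $\widehat{w}_n(\xi)/w_m(\xi)$ is interpreted as $0$. *)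

(* Defs.v *)
From HB Require Import structures.
From mathcomp Require Import all_boot all_order all_algebra.
From mathcomp Require Import all_classical all_reals all_analysis.

Set Implicit Arguments.
Unset Strict Implicit.
Unset Printing Implicit Defensive.

Import Order.TTheory GRing.Theory Num.Theory.
Import numFieldNormedType.Exports.

Local Open Scope classical_set_scope.
Local Open Scope ring_scope.

Definition height (P : {poly int}) : nat := (\max_(i < size P) absz (P`_i)%R)%N.

Definition evalz (R : realType) (P : {poly int}) (xi : R) : R :=
  (map_poly intr P).[xi].

Definition transcendental (R : realType) (xi : R) : Prop :=
  ~ algebraicOver (ratr : rat -> R) xi.

(* [size P <= k.+1] says [deg P <= k]. The suprema are taken in [\bar R];
   for k >= 1 and xi transcendental they are nonnegative, since w = 0 is
   admissible in both sets. *)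
Definition wexp (R : realType) (k : nat) (xi : R) : \bar R :=
  ereal_sup (EFin @` [set w : R |
    infinite_set [set P : {poly int} |
      (size P <= k.+1)%N /\
      0 < `|evalz P xi| <= (height P)%:R `^ (- w)]]).

Definition what (R : realType) (k : nat) (xi : R) : \bar R :=
  ereal_sup (EFin @` [set w : R |
    \forall H \near +oo%R, exists P : {poly int},
      [/\ (size P <= k.+1)%N,
          0 < `|evalz P xi| <= H `^ (- w) &
          (height P)%:R <= H]]).

(* Main.v *)
Require Import Defs.
From HB Require Import structures.
From mathcomp Require Import all_boot all_order all_algebra perm.
From mathcomp Require Import all_classical all_reals all_analysis.
From mathcomp Require Import zify ring lra.

(* Let w_{n-1} < w < w_m. Factoring the polynomials that approximate w_m, and
   using that the height is multiplicative up to constants (Gelfond), one finds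
   primitive irreducible P of degree between n and m and arbitrarily large
   height h with |P(xi)| <= h^(-w). For w' < what_n choose H with
   H^(-w') = |P(xi)| / 2: the uniform exponent yields Q of degree at most n and
   height at most H with |Q(xi)| < |P(xi)|, so that Q is not a multiple of P and
   the resultant of P and Q is a nonzero integer. It is bounded by
     O(h^n H^m (|P(xi)| / h + |Q(xi)| / H)),
   and letting h grow gives w' <= m + (n - 1) w' / w. *)

Set Implicit Arguments.
Unset Strict Implicit.
Unset Printing Implicit Defensive.

Import Order.TTheory GRing.Theory Num.Theory.
Import numFieldNormedType.Exports.

Local Open Scope classical_set_scope.
Local Open Scope ring_scope.

(** * Heights *)

Lemma coef_le_height (P : {poly int}) i : (absz (P`_i)%R <= height P)%N.
Proof.
rewrite /height; case: (ltnP i (size P)) => [lt_i|le_i].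
  exact: (@leq_bigmax _ (fun j : 'I_(size P) => absz P`_j) (Ordinal lt_i)).
by rewrite nth_default.
Qed.

Lemma height_leP (P : {poly int}) B :
  reflect (forall i, absz (P`_i)%R <= B)%N (height P <= B)%N.
Proof.
apply: (iffP idP) => [le_B i|le_B]; first exact: leq_trans (coef_le_height P i) _.
by apply/bigmax_leqP => i _.
Qed.

Lemma height_gt0 (P : {poly int}) : (0 < height P)%N = (P != 0).
Proof.
apply/idP/idP; first by apply: contraTneq => ->; rewrite /height size_poly0 big_ord0.
move=> nzP; apply: leq_trans (coef_le_height P (size P).-1).
by rewrite absz_gt0 -lead_coefE lead_coef_eq0.
Qed.

Lemma absz_horner_le (P : {poly int}) k N x :
  (size P <= k)%N -> (x <= N)%N ->
  (absz P.[x%:Z]%R <= k * N.+1 ^ k * height P)%N.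
Proof.
move=> szP lexN; rewrite (horner_coef_wide _ szP).
have -> : (k * N.+1 ^ k * height P = \sum_(i < k) N.+1 ^ k * height P)%N.
  by rewrite sum_nat_const card_ord mulnA.
apply: (big_ind2 (fun (a : int) b => absz a <= b)%N) => // [a b c d|i _].
  lia.
rewrite abszM abszX mulnC leq_mul ?coef_le_height //=.
apply: (@leq_trans (N.+1 ^ i)).
  by case: (nat_of_ord i) => // j; rewrite leq_exp2r // leqW.
by rewrite leq_pexp2l // ltnW.
Qed.

(* Dividing [Q - Q(x)] by ['X - x] does not increase the values at the other
   integer points by more than a factor 2, as these are at distance at least 1
   from [x]. *)
Lemma height_le_max_values d N : exists C : nat,
  forall (Q : {poly int}) (s : seq nat) M, (size Q <= d)%N -> uniq s ->
    size s = d -> all (leq^~ N) s -> all (fun x => absz Q.[x%:Z]%R <= M)%N s ->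
    (height Q <= C * M)%N.
Proof.
elim: d => [|d [C IH]].
  exists 0%N => Q s M; rewrite leqn0 size_poly_eq0 => /eqP -> _ _ _ _.
  by rewrite leqNgt height_gt0 eqxx.
(* The 1 accounts for the constant Q(x), the factor [N.+1] for multiplication by X - x with x <= N,
   and [C * 2] for the height of the quotient. *)
exists (1 + N.+1 * (C * 2))%N => Q [|x s] // M szQ /= /andP[xs us] [szs].
move=> /andP[xN sN] /andP[QxM QsM].
have /factor_theorem[Q1 DQ1] : root (Q - Q.[x%:Z]%:P) x%:Z.
  by rewrite /root !hornerE subrr.
have DQ : Q = Q1 * ('X - (x%:Z)%:P) + Q.[x%:Z]%:P by rewrite -DQ1 subrK.
have szQ1 : (size Q1 <= d)%N.
  have [->|nzQ1] := eqVneq Q1 0; first by rewrite size_poly0.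
  have := size_Mmonic nzQ1 (monicXsubC x%:Z).
  rewrite -DQ1 size_XsubC addn2 /= -ltnS => <-.
  apply: leq_trans (size_polyD _ _) _; rewrite geq_max szQ size_polyN.
  exact: leq_trans (size_polyC_leq1 _) _.
have hQ1 : (height Q1 <= C * (2 * M))%N.
  apply: (IH Q1 s) => //; apply/allP => y ys.
  have yx : y != x by apply: contraNneq xs => <-.
  have E : Q.[y%:Z] = Q1.[y%:Z] * (y%:Z - x%:Z) + Q.[x%:Z].
    by rewrite {1}DQ !hornerE.
  have QyM : (absz Q.[y%:Z]%R <= M)%N by move/allP: QsM; apply.
  have : (absz (Q1.[y%:Z] * (y%:Z - x%:Z))%R <= 2 * M)%N by lia.
  by rewrite abszM; apply: leq_trans; rewrite leq_pmulr //; lia.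
apply/height_leP => i; rewrite DQ coefD mulrBr coefB coefMX coefMC coefC.
have a1 : (absz (if i == 0%N then 0 else Q1`_i.-1)%R <= C * (2 * M))%N.
  by case: ifP => // _; apply: leq_trans (coef_le_height _ _) hQ1.
have a2 : (absz (Q1`_i * x%:Z)%R <= N * (C * (2 * M)))%N.
  by rewrite abszM mulnC leq_mul //; apply: leq_trans (coef_le_height _ _) hQ1.
have a3 : (absz (if i == 0%N then Q.[x%:Z] else 0)%R <= M)%N by case: ifP.
move: a1 a2 a3; set a := (if _ then _ else _).
set b := _ * _; set c := (if _ then _ else _).
move: a b c => a b c; nia.
Qed.

(** Apply the previous bound with M the largest value on [s]: the maximum is attained, so one point
    alone controls the height. *)
Lemma height_le_value d N : exists C : nat,
  forall (Q : {poly int}) (s : seq nat), (size Q <= d)%N -> uniq s ->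
    size s = d -> all (leq^~ N) s -> Q != 0 ->
    has (fun x => height Q <= C * absz Q.[x%:Z]%R)%N s.
Proof.
have [C HC] := height_le_max_values d N.
exists C => Q s szQ us szs sN; rewrite -height_gt0 => hQ.
apply: contraT; rewrite -all_predC => /allP bad.
pose M := (\max_(x <- s) absz Q.[x%:Z]%R)%N.
have le_M : (height Q <= C * M)%N.
  apply: (HC Q s) => //; apply/allP => x xs.
  exact: (@leq_bigmax_seq _ s xpredT (fun x => absz Q.[x%:Z]%R)).
have : (C * M < height Q)%N.
  rewrite /M big_seq; elim/big_ind: _ => [|a b ha hb|x xs].
  - by rewrite muln0.
  - by case: (leqP a b).
  - by move: (bad x xs) => /=; rewrite -ltnNge.
by rewrite ltnNge le_M.
Qed.

(* Among [2 d - 1] points, each factor is small at no more than [d - 1] of them,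
   hence both are large at a common point. *)
Lemma height_mul_le d : exists2 C : nat, (0 < C)%N &
  forall Q S : {poly int}, (size Q <= d)%N -> (size S <= d)%N ->
    (height Q * height S <= C * height (Q * S)%R)%N.
Proof.
have [C HC] := height_le_value d (2 * d).
pose big (Q : {poly int}) := [pred x : nat | height Q <= C * absz Q.[x%:Z]%R]%N.
pose K := (2 * d * (2 * d).+1 ^ (2 * d))%N.
exists (C * C * K).+1 => // Q S szQ szS.
have [->|nzQ] := eqVneq Q 0.
  by rewrite mul0r; have := height_gt0 0; rewrite eqxx; lia.
have [->|nzS] := eqVneq S 0.
  by rewrite mulr0; have := height_gt0 0; rewrite eqxx; lia.
(* If [T] were small at [d] of the points, [height_le_value] on those points would give a
   contradiction. *)
have cnt (T : {poly int}) : (size T <= d)%N -> T != 0 ->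
    (count (predC (big T)) (iota 0 (2 * d).-1) < d)%N.
  move=> szT nzT; rewrite ltnNge -size_filter; apply/negP => hd.
  pose s := take d [seq x <- iota 0 (2 * d).-1 | predC (big T) x].
  have : has (big T) s.
    apply: HC => //.
    - by rewrite take_uniq // filter_uniq // iota_uniq.
    - by rewrite size_take_min; apply/minn_idPl.
    - apply/allP => x /mem_take; rewrite mem_filter mem_iota => /andP[_].
      lia.
  by case/hasP => x /mem_take; rewrite mem_filter => /andP[/= /negP].
have [x xs /andP[Qx Sx]] :
    exists2 x, x \in iota 0 (2 * d).-1 & big Q x && big S x.
  apply/hasP; apply: contraT; rewrite -all_predC => allbad.
  have : (count (predC (big Q)) (iota 0 (2 * d).-1) +
          count (predC (big S)) (iota 0 (2 * d).-1) >= (2 * d).-1)%N.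
    rewrite -[X in (X <= _)%N](size_iota 0) -count_predUI.
    apply: leq_trans (leq_addr _ _).
    set s := iota _ _; rewrite (_ : count _ s = size s) //; apply/eqP.
    by rewrite -all_count; apply: sub_all allbad => y /=; rewrite negb_and.
  by have := cnt Q szQ nzQ; have := cnt S szS nzS; lia.
have le_x : (x <= 2 * d)%N by move: xs; rewrite mem_iota; lia.
have szQS : (size (Q * S)%R <= 2 * d)%N.
  by apply: leq_trans (size_polyMleq _ _) _; lia.
have := absz_horner_le szQS le_x; rewrite hornerM abszM -/K => le_K.
apply: leq_trans (leq_mul Qx Sx) _; rewrite mulnACA.
apply: (@leq_trans (C * C * (K * height (Q * S)))); last by lia.
by rewrite leq_mul.
Qed.

(** * Values of integer polynomials *)

Lemma finite_poly_height_le k B :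
  finite_set [set P : {poly int} | (size P <= k)%N /\ (height P <= B)%N].
Proof.
(* Coefficients in [-B, B] are shifted by B to become indices. *)
pose F (f : {ffun 'I_k -> 'I_(B + B).+1}) : {poly int} :=
  \sum_(i < k) ((f i)%:Z - B%:Z) *: 'X^i.
apply: (@sub_finite_set _ _ (range F)); last first.
  by apply: finite_image; exact: finite_finset.
move=> P [/= szP hP]; exists [ffun i : 'I_k => inord (absz (P`_i + B%:Z))] => //.
transitivity (\poly_(i < k) P`_i).
  rewrite poly_def; apply: eq_bigr => i _; congr (_ *: _).
  have := coef_le_height P i; rewrite ffunE => le_i; rewrite inordK; last by lia.
  by move: (P`_i) le_i => c; lia.
apply/polyP => i; rewrite coef_poly; case: ltnP => // le_ki.
by rewrite nth_default // (leq_trans szP).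
Qed.

(** Northcott's argument: only finitely many integer polynomials have bounded degree and bounded
    height. *)
Lemma infinite_height_gt k B (A : set {poly int}) :
  infinite_set A -> (forall P, A P -> (size P <= k)%N) ->
  exists2 P, A P & (B < height P)%N.
Proof.
move=> infA szA; apply: contra_notP infA => noP.
apply: sub_finite_set (finite_poly_height_le k B) => P AP.
split; first exact: szA.
by rewrite leqNgt; apply/negP => ltB; apply: noP; exists P.
Qed.

Lemma finite_positive_lower_bound (R : realType) (T : eqType) (A : set T)
    (f : T -> R) :
  finite_set A -> (forall x, A x -> 0 < f x) ->
  exists2 delta, 0 < delta <= 1 & forall x, A x -> delta <= f x.
Proof.
move=> /finite_seqP[s ->]; elim: s => [|y s IH] pos.
  by exists 1; rewrite ?ltr01 ?lexx.
have [x xs|delta /andP[d0 d1] Hd] := IH.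
  by apply: pos; rewrite /= inE [_ \in s]xs orbT.
have fy : 0 < f y by apply: pos; rewrite /= mem_head.
exists (Num.min delta (f y)); first by rewrite lt_min d0 fy ge_min d1.
move=> x /=; rewrite inE => /orP[/eqP->|xs]; first by rewrite ge_min lexx orbT.
by rewrite ge_min Hd.
Qed.

Section Evaluation.
Variables (R : realType) (xi : R).

Lemma evalzM (P Q : {poly int}) : evalz (P * Q) xi = evalz P xi * evalz Q xi.
Proof. by rewrite /evalz rmorphM hornerM. Qed.

Lemma evalzC (c : int) : evalz c%:P xi = c%:~R.
Proof. by rewrite /evalz map_polyC hornerC. Qed.

Lemma evalz0 : evalz 0 xi = 0.
Proof. by rewrite /evalz rmorph0 horner0. Qed.

Lemma evalz_neq0 (P : {poly int}) :
  transcendental xi -> P != 0 -> evalz P xi != 0.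
Proof.
move=> tr nzP; apply/eqP => Pxi; apply: tr; exists (map_poly intr P).
  by rewrite map_poly_eq0_id0 // intr_eq0 lead_coef_eq0.
rewrite /root -map_poly_comp (eq_map_poly (g := intr)) ?Pxi //.
  exact/eqP.
by move=> c /=; rewrite ratr_int.
Qed.

Lemma normr_intr_ge1 (c : int) : c != 0 -> 1 <= `|c%:~R : R|.
Proof. by move=> nzc; rewrite -intr_norm (ler_int _ 1); lia. Qed.

Lemma evalz_mulC_ge (c : int) (P : {poly int}) :
  c != 0 -> `|evalz P xi| <= `|evalz (P * c%:P) xi|.
Proof.
move=> nzc; rewrite evalzM evalzC normrM ler_peMr //.
exact: normr_intr_ge1.
Qed.

Lemma evalz_zprimitive_le (P : {poly int}) :
  P != 0 -> `|evalz (zprimitive P) xi| <= `|evalz P xi|.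
Proof.
move=> nzP; rewrite {2}[P]zpolyEprim -mul_polyC mulrC.
by apply: evalz_mulC_ge; rewrite zcontents_eq0.
Qed.

End Evaluation.

Lemma height_zprimitive_le (P : {poly int}) :
  P != 0 -> (height (zprimitive P) <= height P)%N.
Proof.
move=> nzP; apply/height_leP => i; apply: leq_trans (coef_le_height P i).
rewrite {2}[P]zpolyEprim coefZ abszM leq_pmull //.
by rewrite absz_gt0 zcontents_eq0.
Qed.

(** * Factorization into primitive irreducible polynomials *)

(** For nonconstant [P] this is irreducibility in Z[X] with positive leading coefficient. Its
    negation, for a primitive [P], hands an induction on the size two smaller factors. *)
Definition primitive_irreducible (P : {poly int}) : Prop :=
  zprimitive P = P /\
  forall A B, P = A * B -> ~ ((size A < size P)%N /\ (size B < size P)%N).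

Lemma powRN_le (R : realType) (w a b : R) :
  0 <= w -> 0 < a -> a <= b -> b `^ (- w) <= a `^ (- w).
Proof.
move=> w0 a0 leab; have b0 := lt_le_trans a0 leab.
rewrite !powRN lef_pV2 ?posrE ?powR_gt0 //.
by rewrite ge0_ler_powR // nnegrE ltW.
Qed.

(* Every polynomial factors into primitive irreducible ones, and the height is
   multiplicative up to a constant, so a bound that holds for all but finitely
   many primitive irreducible polynomials holds up to a constant for all. *)
Lemma evalz_lower_bound (R : realType) (xi w : R) m :
  transcendental xi -> 0 <= w ->
  finite_set [set P : {poly int} | [/\ (size P <= m)%N, primitive_irreducible P &
    0 < `|evalz P xi| <= (height P)%:R `^ (- w)]] ->
  exists2 delta, 0 < delta &
    forall P : {poly int}, P != 0 -> (size P <= m)%N ->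
    delta * (height P)%:R `^ (- w) <= `|evalz P xi|.
Proof.
move=> tr w0 finS.
have [|d0 /andP[d0_gt0 d0_le1] Hd0] :=
    finite_positive_lower_bound (f := fun P => `|evalz P xi|) finS.
  by move=> P [_ _ /andP[]].
have pow_le1 (P : {poly int}) : P != 0 -> (height P)%:R `^ (- w) <= (1 : R).
  rewrite -height_gt0 -(ler_nat R) => hP.
  by have := ler_powR hP (_ : - w <= 0); rewrite powRr0 oppr_le0; apply.
have [C C0 HC] := height_mul_le m.
have CR : 0 < (C%:R : R) by rewrite ltr0n.
suff H d : exists2 delta : R, 0 < delta <= 1 &
    forall P : {poly int}, P != 0 -> (size P <= m)%N -> (size P <= d)%N ->
    delta * (height P)%:R `^ (- w) <= `|evalz P xi|.
  have [delta /andP[dl _] Hd] := H m.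
  by exists delta => // P nzP szP; apply: Hd.
elim: d => [|d [dl /andP[dl0 dl1] IH]].
  exists 1; first by rewrite ltr01 lexx.
  by move=> P nzP _; rewrite leqn0 size_poly_eq0 (negPf nzP).
(* [d0] serves the irreducible case; a product costs [dl] once per factor and Gelfond's constant [C]
   to the power -w. *)
pose dl' := Num.min d0 (dl * dl * C%:R `^ (- w)).
have dl'0 : 0 < dl' by rewrite lt_min d0_gt0 !mulr_gt0 ?powR_gt0.
have dl'1 : dl' <= 1 by rewrite ge_min d0_le1.
exists dl' => [|P nzP szPm szPd]; first by rewrite dl'0.
pose P0 := zprimitive P.
have nzP0 : P0 != 0 by rewrite zprimitive_eq0.
have szP0 : size P0 = size P by rewrite size_zprimitive.
(* Passing to the primitive part increases neither the value at xi nor the height, so the inequality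
   for [P0] is the stronger one. *)
suff H : dl' * (height P0)%:R `^ (- w) <= `|evalz P0 xi|.
  apply: le_trans (evalz_zprimitive_le xi nzP); apply: le_trans H.
  rewrite ler_wpM2l ?(ltW dl'0) //.
  by rewrite powRN_le ?ltr0n ?height_gt0 // ler_nat height_zprimitive_le.
have [irr|red] := pselect (primitive_irreducible P0).
  (* Either [P0] is one of the finitely many exceptions, or the bound holds with constant 1. *)
  have [le_P|gt_P] := leP (`|evalz P0 xi|) ((height P0)%:R `^ (- w)).
    apply: (@le_trans _ _ d0); last first.
      by apply: Hd0; split; rewrite ?szP0 // le_P normr_gt0 evalz_neq0.
    apply: (@le_trans _ _ dl'); last by rewrite ge_min lexx.
    by rewrite ler_piMr ?pow_le1 // ltW.
  by apply: le_trans (ltW gt_P); rewrite ler_piMl ?powR_ge0.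
have [A [B [DP ltA ltB]]] : exists A B,
    [/\ P0 = A * B, (size A < size P0)%N & (size B < size P0)%N].
  apply: contra_notP red => noAB; split; first exact: zprimitive_id.
  by move=> A B DP [ltA ltB]; apply: noAB; exists A, B.
have nzA : A != 0 by apply: contraNneq nzP0 => A0; rewrite DP A0 mul0r.
have nzB : B != 0 by apply: contraNneq nzP0 => B0; rewrite DP B0 mulr0.
have [szA szB] : (size A <= m)%N /\ (size B <= m)%N.
  by rewrite -szP0 in szPm; split; apply: leq_trans szPm; apply: ltnW.
have [szAd szBd] : (size A <= d)%N /\ (size B <= d)%N.
  by rewrite -szP0 in szPd; split; rewrite -ltnS; apply: leq_trans szPd.
have HA : dl * (height A)%:R `^ (- w) <= `|evalz A xi| by apply: IH.
have HB : dl * (height B)%:R `^ (- w) <= `|evalz B xi| by apply: IH.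
rewrite {2}DP evalzM normrM.
apply: le_trans (ler_pM _ _ HA HB); rewrite ?mulr_ge0 ?powR_ge0 ?(ltW dl0) //.
rewrite mulrACA -powRM ?ler0n // -natrM.
have le_pow : C%:R `^ (- w) * (height P0)%:R `^ (- w) <=
    (height A * height B)%:R `^ (- w) :> R.
  rewrite -powRM ?ler0n // -natrM powRN_le ?ltr0n ?muln_gt0 ?height_gt0 ?nzA //.
  by rewrite ler_nat DP; apply: HC.
apply: le_trans (ler_wpM2l _ le_pow); last by rewrite mulr_ge0 ?ltW.
by rewrite mulrA ler_wpM2r ?powR_ge0 // ge_min lexx orbT.
Qed.

(** * Resultants *)

(** In the Leibniz expansion each of the at most n! terms takes one entry from every row but [i]. *)
Lemma norm_cofactor_le (R : numFieldType) n (A : 'M[R]_n) (b : 'I_n -> R) i j :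
  (forall k l, `|A k l| <= b k) ->
  `|cofactor A i j| <= n`!%:R * \prod_(k | i != k) b k.
Proof.
move=> leAb; rewrite expand_cofactor; apply: le_trans (ler_norm_sum _ _ _) _.
have b0 k : 0 <= b k by apply: le_trans (leAb k k).
apply: (@le_trans _ _ (\sum_(s : 'S_n) \prod_(k | i != k) b k)).
  rewrite [leRHS](bigID (fun s : 'S_n => s i == j)) /= -[leLHS]addr0 lerD //.
    apply: ler_sum => s _; rewrite normrM normr_sign mul1r normr_prod.
    by apply: ler_prod => k _; rewrite normr_ge0 leAb.
  by apply: sumr_ge0 => s _; apply: prodr_ge0 => k _.
by rewrite sumr_const card_Sn mulr_natl.
Qed.

(* With [v = (1, xi, xi^2, ...)], the entries of [S v] for the Sylvester matrix
   [S] are [xi^k P(xi)] and [xi^k Q(xi)], and Cramer's rule for the first entry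
   of [v] expresses [\det S] through them. *)
Lemma resultant_bound (R : realType) (xi : R) m n : exists2 K : R, 0 < K &
  forall (P Q : {poly int}) (h H : R),
    (1 < size P <= m.+1)%N -> (0 < size Q <= n.+1)%N ->
    1 <= h -> 1 <= H -> (height P)%:R <= h -> (height Q)%:R <= H ->
    resultant P Q != 0 ->
    1 <= K * (h ^+ n * H ^+ m * (`|evalz P xi| / h + `|evalz Q xi| / H)).
Proof.
pose X := 1 + `|xi|; have X1 : 1 <= X by rewrite lerDl.
exists ((m + n).+1%:R * ((m + n)`!%:R * X ^+ (m + n))).
  by rewrite !mulr_gt0 ?ltr0n ?fact_gt0 // exprn_gt0 // (lt_le_trans ltr01).
move=> P Q h H /andP[szP1 szPm] /andP[szQ0 szQn] h1 H1 hP hQ nzres.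
have h0 : 0 < h := lt_le_trans ltr01 h1.
have H0 : 0 < H := lt_le_trans ltr01 H1.
pose dP := (size P).-1; pose dQ := (size Q).-1.
have sP : size P = dP.+1 by rewrite /dP (ltn_predK szP1).
have sQ : size Q = dQ.+1 by rewrite /dQ prednK.
have ledP : (dP <= m)%N by rewrite -ltnS -sP.
have ledQ : (dQ <= n)%N by rewrite -ltnS -sQ.
pose S : 'M[R]_(dQ + dP) := map_mx intr (Sylvester_mx P Q).
pose T : R := `|evalz P xi| / h + `|evalz Q xi| / H.
have T0 : 0 <= T by rewrite addr_ge0 ?divr_ge0 ?(ltW h0) ?(ltW H0).
(* The first [dQ] rows of the Sylvester matrix hold shifts of P, the other [dP] rows shifts of Q. *)
pose b (i : 'I_(dQ + dP)) := match fintype.split i with inl _ => h | inr _ => H end.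
have b0 i : 0 < b i by rewrite /b; case: fintype.split.
have leSb i j : `|S i j| <= b i.
  rewrite /b /S mxE Sylvester_mxE; case: (fintype.split i) => k.
    case: (k <= j)%N; rewrite ?mulr1n ?mulr0n ?normr0 ?(ltW h0) //.
    apply: le_trans hP; rewrite -intr_norm -abszE ler_nat.
    exact: coef_le_height.
  case: (k <= j)%N; rewrite ?mulr1n ?mulr0n ?normr0 ?(ltW H0) //.
  apply: le_trans hQ; rewrite -intr_norm -abszE ler_nat.
  exact: coef_le_height.
pose v : 'cV[R]_(dQ + dP) := \col_j xi ^+ j.
have rowE (F : {poly int}) k : (k + size F <= dQ + dP)%N ->
    \sum_(j < dQ + dP) (F`_(j - k) *+ (k <= j))%:~R * xi ^+ j = xi ^+ k * evalz F xi.
  move=> szF; rewrite -[RHS](_ : evalz ('X^k * F) xi = _); last first.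
    by rewrite evalzM /evalz map_polyXn hornerXn.
  rewrite /evalz (@horner_coef_wide _ (dQ + dP)); last first.
    apply: leq_trans (size_poly _ _) _; apply: leq_trans (size_polyMleq _ _) _.
    by rewrite size_polyXn addSn.
  apply: eq_bigr => j _; rewrite coef_map coefXnM ltnNge.
  by case: (k <= j)%N; rewrite ?mulr1n ?mulr0n.
(* [X] dominates 1 and |xi|, while [h * T] and [H * T] dominate |P(xi)| and |Q(xi)|. *)
have uE i : `|(S *m v) i 0| <= X ^+ (m + n) * (b i * T).
  have -> : (S *m v) i 0 = match fintype.split i with
      inl k => xi ^+ k * evalz P xi | inr k => xi ^+ k * evalz Q xi end.
    rewrite mxE; under eq_bigr => j _ do rewrite [S _ _]mxE [v _ _]mxE Sylvester_mxE.
    case: (fintype.split i) => k; rewrite rowE //.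
      by rewrite sP addnS ltn_add2r.
    by rewrite sQ addnS addnC ltn_add2l.
  have Xk k : (k <= m + n)%N -> `|xi ^+ k| <= X ^+ (m + n).
    move=> lek; rewrite normrX; apply: (@le_trans _ _ (X ^+ k)).
      by rewrite lerXn2r ?nnegrE ?normr_ge0 ?(le_trans ler01) // lerDr.
    by rewrite ler_weXn2l.
  rewrite /b /T; case: (fintype.split i) => k; rewrite normrM ler_pM //.
  - apply: Xk; apply: leq_trans (ltnW (ltn_ord k)) _.
    by rewrite (leq_trans ledQ) // leq_addl.
  - rewrite mulrDr mulrCA divff ?gt_eqF // mulr1 lerDl.
    by rewrite mulr_ge0 ?divr_ge0 ?(ltW h0) ?(ltW H0).
  - apply: Xk; apply: leq_trans (ltnW (ltn_ord k)) _.
    by rewrite (leq_trans ledP) // leq_addr.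
  - rewrite mulrDr [X in _ + X]mulrCA divff ?gt_eqF // mulr1 lerDr.
    by rewrite mulr_ge0 ?divr_ge0 ?(ltW h0) ?(ltW H0).
have N0 : (0 < dQ + dP)%N by rewrite addn_gt0 -(ltnS 1 dP) -sP szP1 orbT.
pose j0 := Ordinal N0.
have detE : (resultant P Q)%:~R = \sum_i cofactor S i j0 * (S *m v) i 0.
  have : (\adj S *m (S *m v)) j0 0 = (\det S *: v) j0 0.
    by rewrite mulmxA mul_adj_mx mul_scalar_mx.
  rewrite !mxE /= expr0 mulr1 det_map_mx => <-.
  by apply: eq_bigr => i _; rewrite !mxE.
have prodb : \prod_i b i <= h ^+ n * H ^+ m.
  have -> : \prod_i b i = h ^+ dQ * H ^+ dP.
    rewrite big_split_ord /= /b; congr (_ * _).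
      under eq_bigr => i _ do rewrite (unsplitK (inl i)).
      by rewrite prodr_const card_ord.
    under eq_bigr => i _ do rewrite (unsplitK (inr i)).
    by rewrite prodr_const card_ord.
  rewrite ler_pM ?exprn_ge0 ?(ltW h0) ?(ltW H0) // ler_weXn2l //.
have term i : `|cofactor S i j0 * (S *m v) i 0| <=
    (m + n)`!%:R * X ^+ (m + n) * (h ^+ n * H ^+ m * T).
  rewrite normrM.
  apply: le_trans (ler_pM _ _ (norm_cofactor_le i j0 leSb) (uE i)) _ => //.
  (* The factor [b i] from the entry of [S v] supplies the row missing in the cofactor, which
     completes the product over all rows. *)
  have -> : forall a c d e g : R, a * c * (d * (e * g)) = a * d * (e * c * g).
    by move=> *; ring.
  have -> : b i * \prod_(k | i != k) b k = \prod_k b k.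
    by rewrite [RHS](bigD1 i) //=; congr (_ * _); apply: eq_bigl => k; rewrite eq_sym.
  have fle : (dQ + dP)`!%:R <= (m + n)`!%:R :> R.
    by rewrite ler_nat; apply: leq_fact; rewrite addnC leq_add.
  have X0 : 0 <= X ^+ (m + n) by rewrite exprn_ge0 // (le_trans ler01).
  apply: ler_pM; first by rewrite mulr_ge0.
  - by rewrite mulr_ge0 // prodr_ge0 // => k _; rewrite ltW.
  - exact: ler_wpM2r.
  - exact: ler_wpM2r.
apply: le_trans (normr_intr_ge1 R nzres) _; rewrite detE.
apply: le_trans (ler_norm_sum _ _ _) _.
apply: le_trans (ler_sum _ (fun i _ => term i)) _.
have X0 : 0 <= X by rewrite (le_trans ler01).
rewrite sumr_const card_ord -[_ *+ _]mulr_natl -[leRHS]mulrA ler_wpM2r //.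
  by rewrite !mulr_ge0 ?exprn_ge0 ?(ltW h0) ?(ltW H0).
by rewrite ler_nat addnC leqW // leq_add.
Qed.

(** A zero resultant means a common factor, which by irreducibility has the degree of P. By Gauss's
    lemma P then divides Q over the integers, so Q = cP with a nonzero integer c, and |Q(xi)| >=
    |P(xi)|. *)
Lemma primitive_irreducible_resultant_neq0 (R : realType) (xi : R)
    (P Q : {poly int}) :
  primitive_irreducible P -> (1 < size P)%N -> Q != 0 ->
  (size Q <= size P)%N -> `|evalz Q xi| < `|evalz P xi| -> resultant P Q != 0.
Proof.
move=> [primP irrP] szP nzQ szQ ltQP; rewrite resultant_eq0.
apply/negP => szgcd.
have [G [szG GP GQ]] : exists G : {poly int}, [/\ (1 < size G)%N, G %| P & G %| Q].
  by exists (gcdp P Q); rewrite dvdp_gcdl dvdp_gcdr.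
have [r DP] := dvdpP_int GP.
have nzP : P != 0 by rewrite -size_poly_gt0 ltnW.
have nzr : r != 0 by apply: contraNneq nzP => r0; rewrite DP r0 mulr0.
have nzG : zprimitive G != 0 by apply: contraNneq nzP => r0; rewrite DP r0 mul0r.
have szPE : size P = (size G + size r).-1.
  by rewrite {1}DP size_mul // size_zprimitive.
have szr : (0 < size r)%N by rewrite size_poly_gt0.
(* A common factor of smaller degree would split P, the cofactor [r] being smaller too as [G] is
   nonconstant. *)
have eqGP : size G = size P.
  apply/eqP; rewrite eqn_leq dvdp_leq //= leqNgt; apply/negP => ltGP.
  apply: (irrP _ _ DP); rewrite size_zprimitive; split => //.
  by rewrite szPE; move: szG; case: (size G) => [|[|g]] //= _; rewrite ltnS leq_addl.
have PQ : P %| Q.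
  apply: dvdp_trans GQ.
  by have : G %= P by [rewrite -dvdp_size_eqp ?eqGP]; case/andP.
have [t DQ] := dvdpP_int PQ; rewrite primP in DQ.
have nzt : t != 0 by apply: contraNneq nzQ => t0; rewrite DQ t0 mulr0.
have szt : (size t <= 1)%N.
  by move: szQ; rewrite {1}DQ size_mul // -subn1 leq_subLR addnC leq_add2r.
move: ltQP; rewrite ltNge DQ (size1_polyC szt) => /negP; apply.
by apply: evalz_mulC_ge; rewrite -polyC_eq0 -size1_polyC.
Qed.

(** * Exponents of approximation *)

Definition w_set (R : realType) (k : nat) (xi w : R) : set {poly int} :=
  [set P : {poly int} | (size P <= k.+1)%N /\
     0 < `|evalz P xi| <= (height P)%:R `^ (- w)].

Lemma wexp_mono (R : realType) (xi : R) k l :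
  (k <= l)%N -> (wexp k xi <= wexp l xi)%E.
Proof.
move=> lekl; apply: ereal_sup_le => _ [w infw <-]; exists w => //.
apply: sub_infinite_set infw => P [szP leP]; split => //.
exact: leq_trans szP _.
Qed.

Lemma w_set_anti (R : realType) (xi w w' : R) k : w' <= w ->
  w_set k xi w `<=` w_set k xi w'.
Proof.
move=> lew P [szP /andP[P0 leP]]; split => //; rewrite P0.
have nzP : P != 0 by apply: contraTneq P0 => ->; rewrite evalz0 normr0 ltxx.
apply: le_trans leP _; rewrite ler_powR ?lerN2 //.
by rewrite (ler_nat R 1) height_gt0.
Qed.

Lemma lt_wexp_infinite (R : realType) (xi w : R) k :
  (w%:E < wexp k xi)%E -> infinite_set (w_set k xi w).
Proof.
move=> /ereal_sup_gt[_ [w' infw <-]]; rewrite lte_fin => ltw.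
exact: sub_infinite_set (w_set_anti (ltW ltw)) infw.
Qed.

Lemma wexp_lt_finite (R : realType) (xi w : R) k :
  (wexp k xi < w%:E)%E -> finite_set (w_set k xi w).
Proof.
move=> ltw; apply: contrapT => inf; move: ltw; rewrite ltNge => /negP; apply.
by apply: ereal_sup_ubound; exists w.
Qed.

(** The set inside [what], with the filter at infinity unfolded into an explicit threshold. *)
Definition what_set (R : realType) (k : nat) (xi : R) : set R :=
  [set w : R | exists H0 : R, forall H, H0 < H -> exists P : {poly int},
      [/\ (size P <= k.+1)%N, 0 < `|evalz P xi| <= H `^ (- w) &
          (height P)%:R <= H]].

Lemma lt_what_what_set (R : realType) (xi w : R) k :
  (w%:E < what k xi)%E -> what_set k xi w.
Proof.
move=> /ereal_sup_gt[_ [w' [H0 [_ HH]] <-]]; rewrite lte_fin => ltw.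
(* The power of H is monotone in the exponent only for H >= 1. *)
exists (Num.max H0 1) => H; rewrite gt_max => /andP[ltH ltH1].
have [P [szP /andP[P0 leP] hP]] := HH H ltH.
exists P; split=> //; rewrite P0 (le_trans leP) //.
by rewrite ler_powR ?lerN2 ?(ltW ltw) ?(ltW ltH1).
Qed.

Lemma what_ge0 (R : realType) (xi : R) k : (0 <= what k xi)%E.
Proof.
apply: ereal_sup_ubound; exists 0 => //; exists 1; split; first exact: real1.
move=> H ltH; exists 1; split; first by rewrite size_poly1.
  by rewrite oppr0 powRr0 -polyC1 evalzC normr1 ltr01 lexx.
apply: le_trans (ltW ltH); rewrite (ler_nat R _ 1).
by apply/height_leP => i; rewrite coef1; case: (i == _).
Qed.

(** If only finitely many P satisfied the bound, their values would stay above some d > 0; yet the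
    solution for an H with H^(-w) <= d/2 is one of them. *)
Lemma what_set_le_wexp (R : realType) (xi w : R) k :
  0 < w -> what_set k xi w -> (w%:E <= wexp k xi)%E.
Proof.
move=> w0 [H0 HH]; apply: ereal_sup_ubound; exists w => // finS.
have [|d /andP[d0 d1] Hd] :=
    finite_positive_lower_bound (f := fun P => `|evalz P xi|) finS.
  by move=> P [_ /andP[]].
pose H := Num.max (H0 + 1) ((d / 2) `^ (- w^-1)).
have Hd2 : H `^ (- w) <= d / 2.
  have -> : d / 2 = ((d / 2) `^ (- w^-1)) `^ (- w).
    rewrite -powRrM mulrNN mulVf ?gt_eqF // powRr1 //; lra.
  apply: powRN_le; first exact: ltW.
    by apply: powR_gt0; lra.
  by rewrite le_max lexx orbT.
have [|P [szP /andP[P0 leP] hP]] := HH H; first by rewrite lt_max; apply/orP; left; lra.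
have nzP : P != 0 by apply: contraTneq P0 => ->; rewrite evalz0 normr0 ltxx.
have /Hd : w_set k xi w P.
  split=> //; rewrite P0 (le_trans leP) // powRN_le ?(ltW w0) //.
  by rewrite ltr0n height_gt0.
by move: (`|_|) leP => x; lra.
Qed.

(** * Irreducible approximations and the key inequality *)

(** Otherwise, as few solutions have degree at most n, all irreducible solutions would be finite in
    number, and |P(xi)| >= d H(P)^(-w) for every P. This contradicts approximation to an order w1 >
    w. *)
Lemma infinite_irreducible (R : realType) (xi w : R) m n :
  transcendental xi -> 0 <= w -> (wexp n xi < w%:E)%E -> (w%:E < wexp m xi)%E ->
  infinite_set [set P : {poly int} | [/\ (n.+1 < size P <= m.+1)%N,
    primitive_irreducible P & 0 < `|evalz P xi| <= (height P)%:R `^ (- w)]].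
Proof.
move=> tr w0 ltn ltm finS.
have [w1 lt_w1 /lt_wexp_infinite inf1] : exists2 w1, w < w1 & (w1%:E < wexp m xi)%E.
  case: (wexp m xi) ltm => [r| |] //; last by exists (w + 1); rewrite ?ltry //; lra.
  by rewrite lte_fin => ltr; exists ((w + r) / 2); rewrite ?lte_fin; lra.
have finU := wexp_lt_finite ltn.
have fin2 : finite_set [set P : {poly int} | [/\ (size P <= m.+1)%N,
    primitive_irreducible P & 0 < `|evalz P xi| <= (height P)%:R `^ (- w)]].
  have := conj finU finS; rewrite -finite_setU; apply: sub_finite_set.
  move=> P [szP irr le_P].
  by have [szn|szn] := leqP (size P) n.+1; [left|right; split=> //; rewrite szn].
have [d d0 Hd] := evalz_lower_bound tr w0 fin2.
(* Beyond this height, H(P)^(-w1) < d H(P)^(-w). *)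
pose B := Num.bound (d^-1 `^ (w1 - w)^-1).
have [P [szP /andP[P0 leP]] ltB] := infinite_height_gt B inf1 (fun P H => proj1 H).
have nzP : P != 0 by apply: contraTneq P0 => ->; rewrite evalz0 normr0 ltxx.
have hP : 0 < (height P)%:R :> R by rewrite ltr0n height_gt0.
have := le_trans (Hd P nzP szP) leP.
rewrite -ler_pdivlMr ?powR_gt0 // -powRB ?(gt_eqF hP) ?implybT //.
have -> : - w1 - - w = - (w1 - w) by ring.
apply/negP; rewrite -ltNge.
have dE : d = (d^-1 `^ (w1 - w)^-1) `^ (- (w1 - w)).
  rewrite -powRrM mulrN mulVf ?gt_eqF ?subr_gt0 // powR_inv1 ?invrK // invr_ge0 ltW //.
rewrite [X in _ < X]dE !powRN ltf_pV2 ?posrE ?powR_gt0 ?invr_gt0 //.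
rewrite gt0_ltr_powR ?subr_gt0 ?nnegrE ?powR_ge0 ?(ltW hP) //.
apply: lt_le_trans (archi_boundP (powR_ge0 _ _)) _.
by rewrite ler_nat ltnW.
Qed.

(** Here p = n - 1, so the irreducible P of degree above p has at least the degree of Q. *)
Lemma what_set_bound (R : realType) (xi w w' : R) m p :
  transcendental xi -> 0 < w' -> w' <= w ->
  (wexp p xi < w%:E)%E -> (w%:E < wexp m xi)%E -> what_set p.+1 xi w' ->
  w' * w <= m%:R * w + p%:R * w'.
Proof.
move=> tr w'0 lew ltp ltm [H0 HH].
have w0 : 0 < w := lt_le_trans w'0 lew.
have [K K0 HK] := resultant_bound xi m p.+1.
rewrite leNgt; apply/negP => gt0e.
pose e := w' * w - (m%:R * w + p%:R * w').
have e0 : 0 < e by rewrite /e; lra.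
pose a := ln (3 * K); pose c := a + ln 2.
(* A height h above [B] exceeds the threshold [H0] and makes e ln h > c w, which the final
   inequality contradicts. *)
pose B := (Num.bound `|H0| + Num.bound (expR (c * w / e)))%N.
have [P [/andP[szP szPm] irrP /andP[y0 ley]] ltB] :=
  infinite_height_gt B (infinite_irreducible tr (ltW w0) ltp ltm)
    (fun P H => let: And3 sz _ _ := H in proj2 (andP sz)).
set y : R := `|evalz P xi| in y0 ley; set h : R := (height P)%:R in ley.
have hB : B%:R < h by rewrite ltr_nat.
have hH0 : H0 < h.
  apply: le_lt_trans (ler_norm H0) _; apply: lt_trans (archi_boundP _) _ => //.
  by apply: le_lt_trans hB; rewrite ler_nat leq_addr.
have hexp : expR (c * w / e) < h.
  apply: lt_trans (archi_boundP (expR_ge0 _)) _.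
  by apply: le_lt_trans hB; rewrite ler_nat leq_addl.
have h1 : 1 <= h by rewrite (ler_nat R 1) (leq_trans _ ltB).
have h0 : 0 < h := lt_le_trans ltr01 h1.
pose H := (y / 2) `^ (- w'^-1).
have y20 : 0 < y / 2 by rewrite divr_gt0.
have H_gt0 : 0 < H by rewrite powR_gt0.
have HE : H `^ (- w') = y / 2.
  by rewrite /H -powRrM mulrNN mulVf ?gt_eqF // powRr1 // ltW.
have l2 : 0 <= ln (2 : R) by rewrite ln_ge0 // (ler_nat R 1).
have lyE : ln y = ln 2 - w' * ln H.
  by have := congr1 (@ln R) HE; rewrite ln_powR ln_div ?posrE //; lra.
have ly_le : ln y <= - w * ln h.
  by rewrite -ln_powR ler_ln ?posrE // powR_gt0.
have L0 : 0 <= ln h by rewrite ln_ge0.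
(* From w' ln H = ln 2 - ln y >= w ln h and w' <= w. *)
have lnhH : ln h <= ln H.
  have : w' * ln h <= w' * ln H by nra.
  by rewrite ler_pM2l.
have leHh : h <= H by rewrite -ler_ln ?posrE.
have H1 : 1 <= H := le_trans h1 leHh.
have [Q [szQ /andP[Q0 leQ] hQ]] := HH H (lt_le_trans hH0 leHh).
rewrite HE in leQ.
have nzQ : Q != 0 by apply: contraTneq Q0 => ->; rewrite evalz0 normr0 ltxx.
have ltQP : `|evalz Q xi| < `|evalz P xi|.
  by rewrite -/y; move: (`|evalz Q xi|) leQ => z; lra.
have res0 : resultant P Q != 0.
  apply: primitive_irreducible_resultant_neq0 ltQP => //.
    exact: leq_trans szP.
  exact: leq_trans szQ szP.
have := HK P Q h H; rewrite szPm szQ size_poly_gt0 nzQ -/y (leq_trans _ szP) //.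
move=> /(_ isT isT h1 H1 (lexx _) hQ res0) le1.
(* Since h <= H and |Q(xi)| <= y/2, the term of P dominates; its division by h lowers the exponent
   from p + 1 to p. *)
have {}le1 : 1 <= 3 * K * (h ^+ p * H ^+ m * y).
  apply: le_trans le1 _.
  have leT : y / h + `|evalz Q xi| / H <= 3 * (y / h).
    have : `|evalz Q xi| / H <= y / 2 / h.
      by rewrite ler_pM ?invr_ge0 ?(ltW H_gt0) // lef_pV2 ?posrE.
    have -> : y / 2 / h = (y / h) / 2 by ring.
    have : 0 <= y / h by rewrite divr_ge0 ?ltW.
    by move: (y / h) (`|evalz Q xi| / H) => u v; lra.
  have -> : 3 * K * (h ^+ p * H ^+ m * y) =
      K * (h ^+ p.+1 * H ^+ m * (3 * (y / h))).
    by rewrite exprS; field; rewrite gt_eqF.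
  by rewrite !ler_wpM2l ?mulr_ge0 ?exprn_ge0 ?(ltW K0) ?(ltW h0) ?(ltW H_gt0).
have K3 : 0 < 3 * K by rewrite mulr_gt0.
have hp : 0 < h ^+ p by rewrite exprn_gt0.
have Hm : 0 < H ^+ m by rewrite exprn_gt0.
have s0 : 0 <= a + (p%:R * ln h + m%:R * ln H + ln y).
  have := ln_ge0 le1; rewrite lnM ?posrE ?mulr_gt0 // -/a.
  rewrite [ln (_ * y)]lnM ?[ln (_ * H ^+ m)]lnM ?posrE ?mulr_gt0 // !lnXn //.
  by rewrite -[ln h *+ p]mulr_natl -[ln H *+ m]mulr_natl.
have ltL : c * w / e < ln h by rewrite -(expRK (c * w / e)) ltr_ln ?posrE ?expR_gt0.
have cL : c * w < e * ln h by rewrite [ltRHS]mulrC -ltr_pdivrMr.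
have eL : e * ln h <= e * ln H by rewrite ler_pM2l.
have s1 : p%:R * (w * ln h) <= p%:R * (w' * ln H).
  by apply: ler_wpM2l => //; lra.
(* Replacing w ln h by the larger w' ln H turns this into e ln H <= c w. *)
have : 0 <= w * (c + (p%:R * ln h + m%:R * ln H - w' * ln H)).
  by apply: mulr_ge0; [exact: ltW|rewrite /c; lra].
move: cL eL s1; rewrite /e; lra.
Qed.

(** * Passage to the suprema in the extended reals *)

Local Open Scope ereal_scope.

Lemma ereal_dense (R : realType) (x y : \bar R) :
  x < y -> exists2 r : R, x < r%:E & r%:E < y.
Proof.
case: x y => [x| |] [y| |] //.
- by rewrite lte_fin => ltxy; exists ((x + y) / 2)%R; rewrite lte_fin; lra.
- by move=> _; exists (x + 1)%R; rewrite ?ltry // lte_fin; lra.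
- by move=> _; exists (y - 1)%R; rewrite ?ltNyr // lte_fin; lra.
- by move=> _; exists 0%R; rewrite ?ltry ?ltNyr.
Qed.

Lemma what_le_wexp (R : realType) (xi : R) k :
  0 < what k xi -> what k xi <= wexp k xi.
Proof.
move=> hat0; rewrite leNgt; apply/negP => lthat.
have [|w] := @ereal_dense _ (maxe (wexp k xi) 0) (what k xi).
  by rewrite gt_max lthat.
rewrite gt_max => /andP[ltw w_gt0] /lt_what_what_set/(what_set_le_wexp w_gt0).
by rewrite leNgt ltw.
Qed.

Lemma what_bound (R : realType) (m p : nat) (xi : R) :
  (p < m)%N -> transcendental xi -> wexp p xi < wexp m xi ->
  what p.+1 xi <= m%:R%:E + p%:R%:E * (what p.+1 xi / wexp m xi).
Proof.
move=> ltpm tr ltw.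
have := what_ge0 xi p.+1; rewrite le_eqVlt => /orP[/eqP<-|hat0].
  by rewrite mul0e mule0 adde0 lee_fin.
have hatm : what p.+1 xi <= wexp m xi.
  exact: le_trans (what_le_wexp hat0) (wexp_mono xi ltpm).
have key (w w' : R) : (0 < w')%R -> (w' <= w)%R -> wexp p xi < w%:E ->
    w%:E < wexp m xi -> w'%:E < what p.+1 xi ->
    (w' * w <= m%:R * w + p%:R * w')%R.
  by move=> w'0 lew ltp ltm /lt_what_what_set; exact: what_set_bound.
case: (wexp m xi) ltw hatm key => [r| |] ltw hatm key.
- case: (what p.+1 xi) hat0 hatm key => [s| |] //.
  rewrite lte_fin lee_fin => s0 lesr key.
  have r0 : (0 < r)%R := lt_le_trans s0 lesr.
  rewrite inver (gt_eqF r0) -!EFinM -EFinD lee_fin.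
  rewrite -(ler_pM2r r0) mulrDl -!mulrA mulVf ?gt_eqF // mulr1 leNgt.
  apply/negP => gt0.
  have [q ltq ltqr] : exists2 q : R, wexp p xi < q%:E & (q < r)%R.
    by have [q ltq] := ereal_dense ltw; rewrite lte_fin; exists q.
  pose d := (s * r - (m%:R * r + p%:R * s))%R.
  have d0 : (0 < d)%R by rewrite /d; lra.
  (* Lowering both exponents by [e] keeps r - e above w_p and s - e positive, and loses at most half
     of the excess [d]. *)
  pose e : R := Num.min (r - q)%R (Num.min (s / 2) (d / (2 * (s + r))))%R.
  have e0 : (0 < e)%R.
    by rewrite !lt_min subr_gt0 ltqr !divr_gt0 // mulr_gt0 // addr_gt0.
  have e1 : (e <= r - q)%R by rewrite ge_min lexx.
  have e2 : (e <= s / 2)%R by rewrite !ge_min lexx orbT.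
  have e3 : (e * (s + r) <= d / 2)%R.
    have : (e <= d / (2 * (s + r)))%R by rewrite !ge_min lexx !orbT.
    have sr : (0 < 2 * (s + r))%R by lra.
    by rewrite ler_pdivlMr //; lra.
  have {}key : ((s - e) * (r - e) <= m%:R * (r - e) + p%:R * (s - e))%R.
    apply: key; [lra|lra| |by rewrite lte_fin; lra|by rewrite lte_fin; lra].
    by apply: lt_le_trans ltq _; rewrite lee_fin; lra.
  have me : (0 <= m%:R * e)%R by rewrite mulr_ge0 // ltW.
  have pe : (0 <= p%:R * e)%R by rewrite mulr_ge0 // ltW.
  have ee : (0 <= e * e)%R by rewrite mulr_ge0 // ltW.
  by move: e3 d0; rewrite /d; lra.
- rewrite (_ : +oo^-1 = 0) // mule0 mule0 adde0 leNgt.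
  apply/negP => /ereal_dense[w' ltw' w'hat]; rewrite lte_fin in ltw'.
  have [q ltq _] := ereal_dense ltw.
  have w'0 : (0 < w')%R by apply: le_lt_trans ltw'.
  (* With w_m infinite, w may grow freely; from [b] on, w (w' - m) >= p w' + 1, contrary to
     [key]. *)
  pose b : R := ((p%:R * w' + 1) / (w' - m%:R))%R.
  pose w : R := Num.max q (Num.max w' b).
  have leb : (b <= w)%R by rewrite !le_max lexx !orbT.
  have : (w' * w <= m%:R * w + p%:R * w')%R.
    apply: key; rewrite ?ltry // ?le_max ?lexx ?orbT //.
    by apply: lt_le_trans ltq _; rewrite lee_fin le_max lexx.
  have : (b * (w' - m%:R) <= w * (w' - m%:R))%R by rewrite ler_pM2r // subr_gt0.
  rewrite /b divfK ?gt_eqF ?subr_gt0 //; lra.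
- by move: hat0 hatm; rewrite leeNy_eq => hat0 /eqP hE; rewrite hE in hat0.
Qed.

(* Division in [\bar R] satisfies x / +oo = 0. *)
Theorem theorem2p2 (R : realType) (m n : nat) (xi : R)
    (hn : (2 <= n)%N) (hmn : (n <= m)%N) (hxi : transcendental xi) :
  ((forall k : nat, (n.-1 <= k <= m)%N -> wexp k xi = wexp n.-1 xi) \/
   what n xi <= m%:R%:E + n.-1%:R%:E * (what n xi / wexp m xi))
  /\
  (wexp n.-1 xi < wexp m xi ->
   what n xi <= m%:R%:E + n.-1%:R%:E * (what n xi / wexp m xi)).
Proof.
have bnd : wexp n.-1 xi < wexp m xi ->
    what n xi <= m%:R%:E + n.-1%:R%:E * (what n xi / wexp m xi).
  have n0 : n.-1.+1 = n by rewrite prednK // ltnW.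
  by have := @what_bound R m n.-1 xi; rewrite n0; apply.
split=> //.
have [/bnd|le_m] := ltP (wexp n.-1 xi) (wexp m xi); first by right.
(* Monotonicity in the degree squeezes w_k between w_{n-1} and w_m <= w_{n-1}. *)
left=> k /andP[lek lekm]; apply/eqP; rewrite eq_le; apply/andP; split.
  exact: le_trans (wexp_mono xi lekm) le_m.
exact: wexp_mono.
Qed.
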